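(* Let $\rho:\Gamma\to GL_p(\mathbb{C})$ be a representation with $\rho(T)=\mathrm{diag}(J_{m_1,\lambda_1},\dots,J_{m_t,\lambda_t})$, $|\lambda_r|=1$. There is a constant $\alpha$ depending only on $\rho$ such that for every $k$ and every $F\in\mathcal{H}(k,\rho)$, each Fourier coefficient sequence $a(n)$ of $F$ satisfies $a(n)=O(n^{k+\alpha})$ as $n\to\infty$; if moreover $F$ is cuspidal then $a(n)=O(n^{k/2+\alpha/2})$ as $n\to\infty$.
   Context: $\Gamma=SL_2(\mathbb{Z})$ acts on the upper half-plane $\mathfrak{H}$ by Möbius transformations; $T=\begin{pmatrix}1&1\\0&1\end{pmatrix}$; $q^x=e^{2\pi i x\tau}$; $\binom{x}{t}=x(x-1)\cdots(x-t+1)/t!$, $\binom{x}{0}=1$. $J_{m,\lambda}$ is the $m\times m$ matrix with $\lambda$ on the diagonal and subdiagonal and $0$ elsewhere ($m_1+\dots+m_t=p$); write $\lambda_r=e^{2\pi i\mu_r}$, $\mu_r\in\mathbb{R}$. For $F=(f_1,\dots,f_p)^t$ holomorphic on $\mathfrak{H}$ with $(c\tau+d)^{-k}F(\gamma\tau)=\rho(\gamma)F(\tau)$ for all $\gamma\in\Gamma$, the components belonging to the $r$th block, suitably indexed as $f_0,\dots,f_{m_r-1}$, satisfy $f_l(\tau+1)=\lambda_r(f_l(\tau)+f_{l-1}(\tau))$ and have expansions $f_l(\tau)=\sum_{u=0}^l\binom{\tau}{u}h_{l-u}(\tau)$ with convergent $h_s(\tau)=\sum_{n\in\mathbb{Z}}a_s(n)q^{n+\mu_r}$;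 the $a_s(n)$ are the Fourier coefficients of $F$. $F$ is holomorphic if all $a_s(n)=0$ whenever $n+\mu_r<0$, cuspidal if whenever $n+\mu_r\le0$; $\mathcal{H}(k,\rho)$ is the space of holomorphic such $F$. *)

(* Defs.v *)
From mathcomp Require Import all_boot all_order all_algebra.
From mathcomp Require Import all_classical all_reals all_analysis.
From mathcomp Require Import complex.

Set Implicit Arguments.
Unset Strict Implicit.
Unset Printing Implicit Defensive.

Import Order.TTheory GRing.Theory Num.Theory.
Import numFieldNormedType.Exports.

Local Open Scope classical_set_scope.
Local Open Scope ring_scope.
Local Open Scope complex_scope.

Definition cexp (R : realType) (z : R[i]) : R[i] :=
  (expR (complex.Re z))%:C * (cos (complex.Im z) +i* sin (complex.Im z)).

(* q^x = exp (2 pi i x tau) *)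
Definition qpow (R : realType) (x : R) (tau : R[i]) : R[i] :=
  cexp ((0 +i* (2 * pi * x)) * tau).

Definition cbinom (R : realType) (x : R[i]) (u : nat) : R[i] :=
  (\prod_(i < u) (x - i%:R)) / (u`!)%:R.

Definition upper_half (R : realType) : set R[i] := [set z | 0 < complex.Im z].

Definition SL2Z : set 'M[int]_2 := [set g | \det g = 1].

Definition matT : 'M[int]_2 :=
  \matrix_(i, j) (if (i == 1) && (j == 0) then 0 else 1).

Definition moebius (R : realType) (g : 'M[int]_2) (z : R[i]) : R[i] :=
  ((g 0 0)%:~R * z + (g 0 1)%:~R) / ((g 1 0)%:~R * z + (g 1 1)%:~R).

(* A representation SL2(Z) -> GL_p(C); the values of rho on integer matrices
   outside SL2(Z) are irrelevant. *)
Record representation (R : realType) (p : nat)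
    (rho : 'M[int]_2 -> 'M[R[i]]_p) : Prop := {
  rep_unit : forall g, SL2Z g -> rho g \in unitmx ;
  rep_one : rho 1%:M = 1%:M ;
  rep_mul : forall g h, SL2Z g -> SL2Z h -> rho (g *m h) = rho g *m rho h
}.

(* lambda on the diagonal AND on the subdiagonal *)
Definition jblock (R : realType) (m : nat) (lambda : R[i]) : 'M[R[i]]_m :=
  \matrix_(i, j) (if (i == j) || (i == j.+1 :> nat) then lambda else 0).

Definition holomorphic_on_upper_half (R : realType) (p : nat)
    (F : R[i] -> 'cV[R[i]]_p) : Prop :=
  forall (i : 'I_p) (tau : R[i]), upper_half tau ->
    derivable (fun z : R[i]^o => F z i 0 : R[i]^o) tau 1.

Definition automorphic (R : realType) (p : nat) (k : int)
    (rho : 'M[int]_2 -> 'M[R[i]]_p) (F : R[i] -> 'cV[R[i]]_p) : Prop :=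
  forall (g : 'M[int]_2) (tau : R[i]), SL2Z g -> upper_half tau ->
    (((g 1 0)%:~R * tau + (g 1 1)%:~R) ^ (- k)) *: F (moebius g tau)
    = rho g *m F tau.

(* The series \sum_(n in Z) u n converges, with sum l. *)
Definition has_zsum (R : realType) (u : int -> R[i]) (l : R[i]) : Prop :=
  exists l1 l2 : R[i]^o,
    [/\ series (fun n : nat => u (Posz n) : R[i]^o) @ \oo --> l1,
        series (fun n : nat => u (Negz n) : R[i]^o) @ \oo --> l2
      & l = l1 + l2].

(* a r s n is the coefficient a_s(n) attached to the r-th Jordan block; only
   the indices s < m r are meaningful.  The component f_l of the r-th block is
   the coordinate tagnat.Rank r l of F. *)
Definition fourier_coeffs (R : realType) (t : nat) (m : 'I_t -> nat)
    (mu : 'I_t -> R) (F : R[i] -> 'cV[R[i]]_(\sum_r m r)%N)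
    (a : 'I_t -> nat -> int -> R[i]) : Prop :=
  exists h : 'I_t -> nat -> R[i] -> R[i],
    (forall (r : 'I_t) (s : nat) (tau : R[i]), (s < m r)%N -> upper_half tau ->
       has_zsum (fun n : int => a r s n * qpow (n%:~R + mu r) tau) (h r s tau))
    /\ (forall (r : 'I_t) (l : 'I_(m r)) (tau : R[i]), upper_half tau ->
       F tau (tagnat.Rank r l) 0
       = \sum_(u < l.+1) cbinom tau u * h r (l - u)%N tau).

Definition holomorphic_form (R : realType) (t : nat) (m : 'I_t -> nat)
    (mu : 'I_t -> R) (F : R[i] -> 'cV[R[i]]_(\sum_r m r)%N) : Prop :=
  exists2 a, fourier_coeffs mu F a &
    forall (r : 'I_t) (s : nat) (n : int), (s < m r)%N ->
      n%:~R + mu r < 0 -> a r s n = 0.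

Definition cuspidal_form (R : realType) (t : nat) (m : 'I_t -> nat)
    (mu : 'I_t -> R) (F : R[i] -> 'cV[R[i]]_(\sum_r m r)%N) : Prop :=
  exists2 a, fourier_coeffs mu F a &
    forall (r : 'I_t) (s : nat) (n : int), (s < m r)%N ->
      n%:~R + mu r <= 0 -> a r s n = 0.

(* The space H(k, rho). *)
Definition Hspace (R : realType) (t : nat) (m : 'I_t -> nat) (mu : 'I_t -> R)
    (k : int) (rho : 'M[int]_2 -> 'M[R[i]]_(\sum_r m r)%N)
    : set (R[i] -> 'cV[R[i]]_(\sum_r m r)%N) :=
  [set F | [/\ holomorphic_on_upper_half F, automorphic k rho F
             & holomorphic_form mu F]].

(* Main.v *)
(* Let h_{r,s} be the coefficient functions of the expansions f_l = sum_u binom(tau,u) h_{l-u},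
   and H(tau) the maximum of their moduli. H has period 1, and F = rho(S)^-1 tau^-k F(-1/tau)
   gives, for |tau| <= 1, H(tau) <= A |tau|^(-k-M) H(-1/tau) with A and M depending only on rho
   (M is the dimension):
   binom(tau,u) is bounded by 1 at tau and by |tau|^-u at -1/tau. Take |Re tau| <= 1/2 and
   y = Im tau < 1/2. The height y'' = y/|tau|^2 of -1/tau is at least 2y and at most 1/y, so
   A <= (y''/y)^beta with beta = log_2 (A + 1), and y^e H(tau) does not decrease when tau is
   replaced by a translate of -1/tau in the strip, where e = k/2 + M/2 + beta. Iterating until
   the height reaches 1/2, where the Fourier series bound H, gives H(tau) = O(y^(-2e)) for
   e >= 0 and O(y^-e) for e < 0; for cuspidal F the decay of H at infinity gives O(y^-e) for
   every e. As |a(n)| exp(-2 pi (n+mu) y) is at most the supremum of H on a horizontal unit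
   segment, the choice y = 1/n (or y = 1/n^2 if e < 0 and F is not cuspidal) concludes. *)
Require Import Defs.
From mathcomp Require Import all_boot all_order all_algebra.
From mathcomp Require Import all_classical all_reals all_analysis.
From mathcomp Require Import complex zify ring lra.

Import Order.TTheory GRing.Theory Num.Theory.
Import numFieldNormedType.Exports.

Set Implicit Arguments.
Unset Strict Implicit.
Unset Printing Implicit Defensive.

Local Open Scope classical_set_scope.
Local Open Scope ring_scope.
Local Open Scope complex_scope.

(** * The real-valued modulus and the complex exponential *)

Section Modulus.
Variable R : realType.
Implicit Types z w : R[i].

Definition absc z : R := complex.Re `|z|.

Lemma abscE z : `|z| = (absc z)%:C.
Proof. by rewrite /absc RRe_real // normr_real. Qed.

Lemma absc_sqrt z : absc z = Num.sqrt (complex.Re z ^+ 2 + complex.Im z ^+ 2).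
Proof. by rewrite /absc normc_def. Qed.

Lemma sqr_absc z : absc z ^+ 2 = complex.Re z ^+ 2 + complex.Im z ^+ 2.
Proof. by rewrite absc_sqrt sqr_sqrtr // addr_ge0 // sqr_ge0. Qed.

Lemma absc_ge0 z : 0 <= absc z. Proof. by rewrite absc_sqrt sqrtr_ge0. Qed.

Lemma abscM z w : absc (z * w) = absc z * absc w.
Proof. by apply: complexI; rewrite rmorphM -!abscE normrM. Qed.

Lemma abscN z : absc (- z) = absc z. Proof. by rewrite /absc normrN. Qed.

Lemma absc0 : absc 0 = 0. Proof. by rewrite /absc normr0. Qed.

Lemma absc1 : absc 1 = 1. Proof. by rewrite /absc normr1. Qed.

Lemma absc_eq0 z : (absc z == 0) = (z == 0).
Proof. by rewrite -(inj_eq (@complexI R)) -abscE normr_eq0. Qed.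

Lemma absc_gt0 z : (0 < absc z) = (z != 0).
Proof. by rewrite lt0r absc_eq0 absc_ge0 andbT. Qed.

Lemma abscV z : absc z^-1 = (absc z)^-1.
Proof. by apply: complexI; rewrite fmorphV -!abscE normfV. Qed.

Lemma absc_real (x : R) : 0 <= x -> absc x%:C = x.
Proof. by move=> x0; rewrite /absc ger0_norm // ler0c. Qed.

Lemma absc_nat n : absc n%:R = n%:R.
Proof. by rewrite /absc normr_nat -(rmorph_nat (real_complex R)). Qed.

Lemma abscX z n : absc (z ^+ n) = absc z ^+ n.
Proof. by apply: complexI; rewrite rmorphXn -!abscE normrX. Qed.

Lemma abscXz z (n : int) : absc (z ^ n) = absc z ^ n.
Proof.
by case: n => n; [exact: abscX | rewrite NegzE -!exprnN abscV abscX].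
Qed.

Lemma ler_abscD z w : absc (z + w) <= absc z + absc w.
Proof. by rewrite -lecR rmorphD /= -!abscE ler_normD. Qed.

Lemma absc_sum (I : Type) (r : seq I) (P : pred I) (f : I -> R[i]) :
  absc (\sum_(i <- r | P i) f i) <= \sum_(i <- r | P i) absc (f i).
Proof.
elim/big_rec2: _ => [|i x y _ le_yx]; first by rewrite absc0.
by apply: le_trans (ler_abscD _ _) _; rewrite lerD2l.
Qed.

Lemma absc_prod n (f : 'I_n -> R[i]) :
  absc (\prod_(i < n) f i) = \prod_(i < n) absc (f i).
Proof. exact: (big_morph absc abscM absc1). Qed.

Lemma absc_expi (x : R) : absc (cos x +i* sin x) = 1.
Proof. by rewrite absc_sqrt /= cos2Dsin2 sqrtr1. Qed.

Lemma cexpD z w : cexp (z + w) = cexp z * cexp w.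
Proof.
case: z w => [a b] [c d]; rewrite /cexp /= expRD cosD sinD.
by simpc; congr (_ +i* _); ring.
Qed.

Lemma cexp0 : cexp 0 = 1 :> R[i].
Proof. by rewrite /cexp /= expR0 cos0 sin0; simpc. Qed.

Lemma absc_cexp z : absc (cexp z) = expR (complex.Re z).
Proof. by rewrite abscM absc_expi mulr1 absc_real // expR_ge0. Qed.

Lemma cexp_neq0 z : cexp z != 0.
Proof. by rewrite -absc_gt0 absc_cexp expR_gt0. Qed.

Lemma cexpMn z n : cexp (z *+ n) = cexp z ^+ n.
Proof.
by elim: n => [|n IH]; rewrite ?mulr0n ?cexp0 ?expr0 // mulrS cexpD IH exprS.
Qed.

Lemma cexp2pi_int (n : int) : cexp (0 +i* (2 * pi * n%:~R)) = 1 :> R[i].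
Proof.
have nat_case k : cexp (0 +i* (2 * pi * k%:R)) = 1 :> R[i].
  have -> : 0 +i* (2 * pi * k%:R) = (0 +i* (pi *+ 2)) *+ k :> R[i].
    by rewrite -[RHS]mulr_natr -(rmorph_nat (real_complex R)); simpc; congr (_ +i* _); ring.
  by rewrite cexpMn /cexp /= cos2pi sin2pi expR0; simpc; rewrite expr1n.
case: n => k; first exact: nat_case.
(* [Negz k] is -(k + 1), so multiplying by the exponential for k + 1 reduces to the natural case. *)
apply: (mulIf (cexp_neq0 (0 +i* (2 * pi * k.+1%:R)))).
rewrite -cexpD nat_case mul1r NegzE mulrNz -[RHS]cexp0; congr cexp.
by simpc; congr (_ +i* _); ring.
Qed.

(** The value 1 would force cos(2 pi x) = 1, hence sin(pi x) = 0 by the double-angle formula, but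
    this sine is positive on (0, 1). *)
Lemma cexp2pi_neq1 (x : R) : 0 < x < 1 -> cexp (0 +i* (2 * pi * x)) != 1 :> R[i].
Proof.
move=> /andP[x0 x1]; apply/eqP; rewrite /cexp /= expR0 => E.
have : cos (2 * pi * x) = 1 by move: E; simpc => -[].
have -> : 2 * pi * x = (pi * x) *+ 2 by rewrite -mulr_natr; ring.
have : 0 < sin (pi * x).
  by apply: sin_gt0_pi; rewrite mulr_gt0 ?pi_gt0 //= gtr_pMr ?pi_gt0.
rewrite cos_mulr2n; have := cos2Dsin2 (pi * x); nra.
Qed.

End Modulus.

(** * Convergent one-sided and two-sided complex series *)

Section Series.
Variable R : realType.
Implicit Types (u : nat -> R[i]) (l : R[i]).

Lemma cvg_series_absc u l :
    series (u : nat -> R[i]^o) @ \oo --> (l : R[i]^o) ->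
  forall e : R, 0 < e -> exists N, forall n, (N <= n)%N ->
    absc (l - \sum_(0 <= i < n) u i) <= e.
Proof.
move=> /cvgrPdist_le cv e e0.
have /cv[N _ HN] : 0 < e%:C by rewrite ltcR.
by exists N => n Nn; have := HN n Nn; rewrite /= abscE lecR.
Qed.

Lemma cvg_series_terms_bounded u l :
  series (u : nat -> R[i]^o) @ \oo --> (l : R[i]^o) ->
  exists B, forall n, absc (u n) <= B.
Proof.
move=> /cvg_series_absc /(_ 1 ltr01)[N HN].
(* From N on, a term is the difference of two remainders of modulus at most 1, hence the 2; the sum
   covers the earlier terms. *)
exists (2 + \sum_(0 <= i < N) absc (u i)) => n.
have S0 (s : seq nat) : 0 <= \sum_(i <- s) absc (u i).
  by apply: sumr_ge0 => *; exact: absc_ge0.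
have [nN|Nn] := ltnP n N.
  rewrite (@big_cat_nat _ _ _ n) ?(ltnW nN) //= (@big_ltn _ _ _ n) //=.
  have := S0 (index_iota 0 n); have := S0 (index_iota n.+1 N).
  lra.
have -> : u n = (l - \sum_(0 <= i < n) u i) - (l - \sum_(0 <= i < n.+1) u i).
  by rewrite big_nat_recr //=; ring.
apply: le_trans (ler_abscD _ _) _; rewrite abscN.
have := HN n Nn; have := HN n.+1 (leqW Nn); have := S0 (index_iota 0 N); lra.
Qed.

Lemma geometric_tail_le (x : R) (m n : nat) :
  0 <= x < 1 -> \sum_(m <= i < n) x ^+ i <= x ^+ m / (1 - x).
Proof.
move=> /andP[x0 x1]; have [nm|mn] := leqP n m.
  by rewrite big_geq // divr_ge0 ?exprn_ge0 // subr_ge0 ltW.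
rewrite -(subnKC (ltnW mn)) geometric_partial_tail geometric_seriesE ?lt_eqF //=.
by rewrite ler_pM2r ?invr_gt0 ?subr_gt0 // ler_piMr ?exprn_ge0 // gerBl exprn_ge0.
Qed.

Lemma cvg_series_geometric_tail u l (B x : R) (m : nat) : 0 <= x < 1 ->
  series (u : nat -> R[i]^o) @ \oo --> (l : R[i]^o) ->
  (forall n, absc (u n) <= B * x ^+ n) ->
  absc (l - \sum_(0 <= i < m) u i) <= B * x ^+ m / (1 - x).
Proof.
move=> x01 /cvg_series_absc cv uB; apply/ler_addgt0Pr => e /cv[N HN].
have B0 : 0 <= B by have := uB 0; rewrite expr0 mulr1; apply: le_trans (absc_ge0 _).
have -> : l - \sum_(0 <= i < m) u i =
  \sum_(m <= i < maxn N m) u i + (l - \sum_(0 <= i < maxn N m) u i).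
  by rewrite [X in _ = _ + (_ - X)](@big_cat_nat _ _ _ m) ?leq_maxr //=; ring.
apply: le_trans (ler_abscD _ _) _; apply: lerD; last by rewrite HN // leq_maxl.
apply: le_trans (absc_sum _ _ _) _.
apply: (@le_trans _ _ (\sum_(m <= i < maxn N m) B * x ^+ i)); first exact: ler_sum.
by rewrite -mulr_sumr -mulrA ler_wpM2l // geometric_tail_le.
Qed.

(** The partial sum runs over -m <= n < m and the factor 2 counts the two tails. The case m = 0
    bounds the sum itself. *)
Lemma has_zsum_geometric_tail (u : int -> R[i]) l (B x : R) (m : nat) : 0 <= x < 1 ->
  has_zsum u l ->
  (forall n, absc (u (Posz n)) <= B * x ^+ n /\ absc (u (Negz n)) <= B * x ^+ n) ->
  absc (l - (\sum_(0 <= i < m) u (Negz i) + \sum_(0 <= i < m) u (Posz i)))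
    <= 2 * (B * x ^+ m / (1 - x)).
Proof.
move=> x01 [l1 [l2 [cv1 cv2 ->]]] uB.
have := cvg_series_geometric_tail m x01 cv1 (fun n => (uB n).1).
have := cvg_series_geometric_tail m x01 cv2 (fun n => (uB n).2).
set S1 := \sum_(_ <= _ < _) _; set S2 := \sum_(_ <= _ < _) _ => h1 h2.
rewrite (_ : _ - _ = (l1 - S2) + (l2 - S1)); last by ring.
by apply: le_trans (ler_abscD _ _) _; lra.
Qed.

(** Serves for integer translations of tau, which multiply all terms of a Fourier series by one
    constant. *)
Lemma has_zsum_scale (c : R[i]) (u v : int -> R[i]) l l' :
  (forall n, v n = c * u n) -> has_zsum u l -> has_zsum v l' -> l' = c * l.
Proof.
move=> vE [l1 [l2 [cu1 cu2 ->]]] [k1 [k2 [cv1 cv2 ->]]].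
have cv_scale w z d d' : (forall n, z n = c * w n) ->
    series (w : nat -> R[i]^o) @ \oo --> (d : R[i]^o) ->
    series (z : nat -> R[i]^o) @ \oo --> (d' : R[i]^o) -> d' = c * d.
  move=> zE cw cz; apply: (cvg_unique (@norm_hausdorff _ _) cz).
  rewrite (_ : series _ = fun n => (c : R[i]^o) * series (w : nat -> R[i]^o) n).
    exact: (@cvgM R[i] nat \oo _ (cst (c : R[i]^o)) _ _ _ (cvg_cst _) cw).
  by apply/funext => n; rewrite /series /= mulr_sumr; apply: eq_bigr => i _; rewrite zE.
rewrite mulrDr; congr (_ + _).
  by apply: cv_scale cu1 cv1 => n; exact: vE.
by apply: cv_scale cu2 cv2 => n; exact: vE.
Qed.

End Series.

(** * Finite Fourier inversion at the N-th roots of unity *)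

Section DiscreteFourier.
Variables (R : realType) (N : nat).
Hypothesis N0 : (0 < N)%N.

Let zeta : R[i] := cexp (0 +i* (2 * pi * N%:R^-1)).

Lemma zetaX n : zeta ^+ n = cexp (0 +i* (2 * pi * (n%:R / N%:R))).
Proof.
rewrite -cexpMn; congr cexp.
by rewrite -[LHS]mulr_natr -(rmorph_nat (real_complex R)); simpc; congr (_ +i* _); ring.
Qed.

Lemma absc_zeta : absc zeta = 1.
Proof. by rewrite absc_cexp /= expR0. Qed.

Lemma zetaXN : zeta ^+ N = 1.
Proof. by rewrite zetaX divff ?pnatr_eq0 -?lt0n // (cexp2pi_int R 1%Z). Qed.

Lemma zetaX_neq1 n : (0 < n < N)%N -> zeta ^+ n != 1.
Proof.
move=> /andP[n0 nN]; rewrite zetaX cexp2pi_neq1 // divr_gt0 ?ltr0n //=.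
by rewrite ltr_pdivrMr ?ltr0n // mul1r ltr_nat.
Qed.

(** The exponent N - k stands for -k within the naturals. Off the diagonal this is a geometric sum
    whose ratio z differs from 1 while z^N = 1. *)
Lemma zeta_orthogonality (i k : 'I_N) :
  \sum_(j < N) zeta ^+ (i * j) * zeta ^+ ((N - k) * j) = (if i == k then N%:R else 0).
Proof.
under eq_bigr do rewrite -exprD -mulnDl exprM.
have [->|ik] := eqVneq i k.
  rewrite subnKC 1?ltnW // zetaXN.
  by under eq_bigr do rewrite expr1n; rewrite sumr_const card_ord.
have z1 : zeta ^+ (i + (N - k)) != 1.
  have [iN kN] := (ltn_ord i, ltn_ord k).
  have [lt_ik|lt_ki|eq_ik] := ltngtP i k; last by rewrite (val_inj eq_ik) eqxx in ik.
    by rewrite zetaX_neq1 //; lia.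
  rewrite (_ : (i + (N - k) = N + (i - k))%N); last lia.
  by rewrite exprD zetaXN mul1r zetaX_neq1 //; lia.
apply/eqP; rewrite -(inj_eq (@mulfI _ (zeta ^+ (i + (N - k)) - 1) _)) ?subr_eq0 //.
by rewrite mulr0 -subrX1 -exprM mulnC exprM zetaXN expr1n subrr.
Qed.

(** By orthogonality a coefficient is an average of the N sampled values times numbers of modulus 1.
    This replaces the integral formula for Fourier coefficients. *)
Lemma absc_coef_le (c : nat -> R[i]) (M : R) (k : 'I_N) :
  (forall j : 'I_N, absc (\sum_(i < N) c i * zeta ^+ (i * j)) <= M) -> absc (c k) <= M.
Proof.
move=> cM.
have E : N%:R * c k =
    \sum_(j < N) (\sum_(i < N) c i * zeta ^+ (i * j)) * zeta ^+ ((N - k) * j).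
  under eq_bigr do rewrite mulr_suml.
  rewrite exchange_big /=.
  under eq_bigr do under eq_bigr do rewrite -mulrA.
  under eq_bigr do rewrite -mulr_sumr zeta_orthogonality.
  rewrite (bigD1 k) //= eqxx mulrC big1 ?addr0 // => i /negPf ->.
  by rewrite mulr0.
have : absc (N%:R * c k) <= N%:R * M.
  rewrite E; apply: le_trans (absc_sum _ _ _) _.
  rewrite mulr_natl -[N in _ *+ N]card_ord -sumr_const; apply: ler_sum => j _.
  by rewrite abscM abscX absc_zeta expr1n mulr1.
by rewrite abscM absc_nat ler_pM2l ?ltr0n.
Qed.

End DiscreteFourier.

(** * Fourier series on the upper half-plane *)

Section QSeries.
Variables (R : realType) (mu : R) (a : int -> R[i]) (h : R[i] -> R[i]).

Lemma absc_qpow (x : R) tau : absc (qpow x tau) = expR (- (2 * pi * x * complex.Im tau)).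
Proof. by case: tau => u v; rewrite absc_cexp; simpc. Qed.

Lemma qpowDr (x c : R) tau :
  qpow x (tau + c%:C) = cexp (0 +i* (2 * pi * (x * c))) * qpow x tau.
Proof.
case: tau => u v; rewrite -cexpD; congr cexp.
by simpc; congr (_ +i* _); ring.
Qed.

(** The modulus of the n-th term at any point of height y; the real part of the point does not
    affect it. *)
Definition coef_size (y : R) (n : int) : R :=
  absc (a n) * expR (- (2 * pi * (n%:~R + mu) * y)).

Hypothesis hE : forall tau, upper_half tau ->
  has_zsum (fun n : int => a n * qpow (n%:~R + mu) tau) (h tau).

Lemma absc_qterm n tau :
  absc (a n * qpow (n%:~R + mu) tau) = coef_size (complex.Im tau) n.
Proof. by rewrite abscM absc_qpow. Qed.

(* Convergence at heights y/2 and 3y/2 controls the positive and the negative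
   coefficients respectively, with room for the factor exp(-pi y n). *)
Lemma coef_size_geometric (y : R) : 0 < y ->
  exists B x : R, 0 <= x < 1 /\
    forall n : nat, coef_size y (Posz n) <= B * x ^+ n
                 /\ coef_size y (Negz n) <= B * x ^+ n.
Proof.
move=> y0.
have up (v : R) : 0 < v -> upper_half (0 +i* v) by [].
have [|l1 [_ [cv _ _]]] := hE (up (y / 2) _); first by rewrite divr_gt0.
have [|_ [l2 [_ cv2 _]]] := hE (up (3 * y / 2) _); first by lra.
have [B1 HB1] := cvg_series_terms_bounded cv.
have [B2 HB2] := cvg_series_terms_bounded cv2.
pose E1 := expR (- (pi * mu * y)); pose E2 := expR (pi * (mu - 1) * y).
have [B10 B20] : 0 <= B1 /\ 0 <= B2.
  by split; [apply: le_trans (HB1 0%N)|apply: le_trans (HB2 0%N)]; exact: absc_ge0.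
have [E10 E20] : 0 <= E1 /\ 0 <= E2 by split; exact: expR_ge0.
exists (B1 * E1 + B2 * E2), (expR (- (pi * y))); split.
  by rewrite expR_ge0 expR_lt1 oppr_lt0 mulr_gt0 ?pi_gt0.
move=> n; rewrite -expRM_natr; split.
  apply: (@le_trans _ _ (B1 * (E1 * expR (- (pi * y) * n%:R)))); last first.
    by rewrite mulrA ler_wpM2r ?expR_ge0 // lerDl mulr_ge0.
  rewrite /coef_size /E1 -expRD; have := HB1 n; rewrite absc_qterm /coef_size /= => H.
  rewrite (_ : - (2 * pi * _ * y) = - (2 * pi * (n%:~R + mu) * (y / 2)) +
    (- (pi * mu * y) + - (pi * y) * n%:R)); last by rewrite -pmulrn; lra.
  by rewrite [in leLHS]expRD [leLHS]mulrA ler_wpM2r ?expR_ge0.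
apply: (@le_trans _ _ (B2 * (E2 * expR (- (pi * y) * n%:R)))); last first.
  by rewrite mulrA ler_wpM2r ?expR_ge0 // lerDr mulr_ge0.
rewrite /coef_size /E2 -expRD; have := HB2 n; rewrite absc_qterm /coef_size /= => H.
rewrite (_ : - (2 * pi * _ * y) = - (2 * pi * ((Negz n)%:~R + mu) * (3 * y / 2)) +
  (pi * (mu - 1) * y + - (pi * y) * n%:R)); last first.
  by rewrite NegzE mulrNz -pmulrn -[n.+1%:R]natr1; lra.
by rewrite [in leLHS]expRD [leLHS]mulrA ler_wpM2r ?expR_ge0.
Qed.

(** Translation by j multiplies each term by exp(2 pi i mu j), because exp(2 pi i n j) = 1. This
    factor has modulus 1, so the modulus of [h] is periodic. *)
Lemma absc_qseries_periodic (j : int) tau :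
  upper_half tau -> absc (h (tau + (j%:~R)%:C)) = absc (h tau).
Proof.
move=> Htau; have Htau' : upper_half (tau + (j%:~R)%:C).
  by case: tau Htau => u v; rewrite /upper_half /= addr0.
pose c : R[i] := cexp (0 +i* (2 * pi * (mu * j%:~R))).
rewrite (has_zsum_scale (c := c) _ (hE Htau) (hE Htau')) => [|n].
  by rewrite abscM absc_cexp /= expR0 mul1r.
rewrite qpowDr mulrCA; congr (_ * _).
rewrite (_ : 0 +i* _ = 0 +i* (2 * pi * (mu * j%:~R)) + 0 +i* (2 * pi * (n * j)%:~R)).
  by rewrite cexpD cexp2pi_int mulr1.
by rewrite intrM; simpc; congr (_ +i* _); ring.
Qed.

(** Raising the height from 1/2 to v shrinks each nonzero term by at least exp(-2 pi d (v - 1/2)).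
    Taking d = 0 gives boundedness for holomorphic forms, d > 0 the decay of cuspidal ones. *)
Lemma qseries_le (d : R) : 0 <= d -> (forall n, a n != 0 -> d <= n%:~R + mu) ->
  exists2 C, 0 <= C & forall tau, 2^-1 <= complex.Im tau ->
    absc (h tau) <= C * expR (- (2 * pi * d * (complex.Im tau - 2^-1))).
Proof.
move=> d0 ad; have half0 : 0 < 2^-1 :> R by rewrite invr_gt0.
have [B [x [x01 Bx]]] := coef_size_geometric half0.
have B0 : 0 <= B.
  have [+ _] := Bx 0%N; rewrite expr0 mulr1; apply: le_trans.
  by rewrite mulr_ge0 ?expR_ge0 ?absc_ge0.
exists (2 * (B / (1 - x))) => [|tau Htau].
  by rewrite mulr_ge0 // divr_ge0 // subr_ge0; case/andP: x01 => _ /ltW.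
set E := expR _.
have E0 : 0 <= E by exact: expR_ge0.
have size_le n : coef_size (complex.Im tau) n <= E * coef_size 2^-1 n.
  rewrite /coef_size; have [->|/ad dn] := eqVneq (a n) 0.
    by rewrite absc0 !mul0r mulr0.
  rewrite mulrCA ler_wpM2l ?absc_ge0 // -expRD ler_expR.
  have := pi_ge0 R; move: Htau dn; set v := complex.Im tau; set w := _ + mu.
  move=> Hv Hw Hpi; have : 0 <= pi * ((w - d) * (v - 2^-1)).
    by rewrite !mulr_ge0 // subr_ge0.
  by lra.
have Htau' : upper_half tau by exact: lt_le_trans Htau.
have := has_zsum_geometric_tail (B := E * B) 0 x01 (hE Htau').
rewrite !big_geq // addr0 subr0 expr0 mulr1.
rewrite (_ : 2 * (B / _) * E = 2 * (E * B / (1 - x))); last by ring.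
apply => n; rewrite !absc_qterm -!mulrA.
by split; apply: le_trans (size_le _) _; rewrite ler_wpM2l //; have [] := Bx n.
Qed.

(** The series is cut to the window -L <= n < L, sampled at 2L equally spaced points of the segment
    and inverted by the finite Fourier transform; the truncation error [T L] tends to 0. *)
Lemma coef_size_le (y M : R) (n : int) : 0 < y ->
  (forall x : R, - 2^-1 <= x <= 2^-1 -> absc (h (x +i* y)) <= M) ->
  coef_size y n <= M.
Proof.
move=> y0 hM; have [B [x [x01 Bx]]] := coef_size_geometric y0.
have [x0 x1] := andP x01.
pose T L := 2 * (B * x ^+ L / (1 - x)).
have main L : (`|n| < L)%N -> coef_size y n <= M + T L.
  move=> nL; have N0 : (0 < L + L)%N by lia.
  pose u tau (k : int) := a k * qpow (k%:~R + mu) tau.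
  (* Index i in 0, ..., 2L - 1 stands for the frequency i - L, and the base point is the left end of
     the segment. *)
  pose c i := u ((- 2^-1) +i* y) (i%:Z - L%:Z).
  have kL : (absz (n + L%:Z)%R < L + L)%N by lia.
  have -> : coef_size y n = absc (c (Ordinal kL)).
    rewrite /c /u absc_qterm /=; congr coef_size; lia.
  apply: (absc_coef_le N0) => j.
  pose t : R := j%:R / (L + L)%:R.
  have t01 : 0 <= t < 1.
    by rewrite divr_ge0 //= ltr_pdivrMr ?ltr0n // mul1r ltr_nat.
  have [t0 /ltW t1] := andP t01.
  pose tau : R[i] := (- 2^-1 + t) +i* y.
  (* Moving from the left end by t = j / (2L) multiplies term i by exp(2 pi i (mu - L) t), common to
     all terms, and by the root of unity [zeta ^+ (i * j)]. *)
  pose v : R[i] := cexp (0 +i* (2 * pi * ((mu - L%:R) * t))).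
  have shift (i : nat) : u tau (i%:Z - L%:Z) =
      v * (c i * cexp (0 +i* (2 * pi * (L + L)%:R^-1)) ^+ (i * j)).
    rewrite zetaX /c /u (_ : tau = (- 2^-1) +i* y + t%:C); last by rewrite /tau; simpc.
    rewrite qpowDr; set w := cexp (0 +i* (2 * pi * ((i * j)%:R / _))).
    have -> : cexp (0 +i* (2 * pi * (((i%:Z - L%:Z)%:~R + mu) * t))) = v * w.
      rewrite -cexpD; congr cexp.
      by rewrite rmorphB /= -!pmulrn natrM /t; simpc; congr (_ +i* _); ring.
    ring.
  pose S := \sum_(0 <= i < L) u tau (Negz i) + \sum_(0 <= i < L) u tau (Posz i).
  have -> : \sum_(i < L + L) c i * cexp (0 +i* (2 * pi * (L + L)%:R^-1)) ^+ (i * j)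
      = v^-1 * S.
    apply: (@mulfI _ v); first exact: cexp_neq0.
    rewrite mulrA divff ?cexp_neq0 // mul1r mulr_sumr.
    under eq_bigr do rewrite -shift.
    rewrite big_split_ord /= /S !big_mkord; congr (_ + _).
      rewrite (reindex_inj rev_ord_inj) /=; apply: eq_bigr => i _.
      by congr u; have := ltn_ord i; lia.
    by apply: eq_bigr => i _; congr u; lia.
  have Htau : upper_half tau by [].
  have HS := has_zsum_geometric_tail (B := B) L x01 (hE Htau).
  rewrite abscM abscV absc_cexp /= expR0 invr1 mul1r (_ : S = h tau - (h tau - S)); last by ring.
  apply: le_trans (ler_abscD _ _) _; rewrite abscN; apply: lerD.
    by apply: hM; apply/andP; split; lra.
  by apply: HS => i; rewrite !absc_qterm.
have T0 : T @ \oo --> (0 : R).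
  have -> : T = geometric (2 * B / (1 - x)) x.
    by apply/funext => L; rewrite /T /geometric /=; ring.
  by apply: cvg_geometric; rewrite ger0_norm.
apply/ler_addgt0Pr => e e0.
move/cvgrPdist_le: T0 => /(_ e e0)[N _ HN].
have := main (maxn N `|n|.+1) ; rewrite leq_max ltnSn orbT => /(_ isT).
have := HN (maxn N `|n|.+1) (leq_maxl _ _); rewrite /= sub0r normrN.
move=> /(le_trans (ler_norm _)); lra.
Qed.

End QSeries.

(** * Transfer of bounds across tau -> -1/tau and descent in the strip *)

Lemma absc_cbinom_le (R : realType) (tau : R[i]) (c : R) (u : nat) :
  1 <= c -> absc tau <= c -> absc (cbinom tau u) <= c ^+ u.
Proof.
move=> c1 tc; rewrite /cbinom abscM abscV absc_prod absc_nat.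
rewrite ler_pdivrMr ?ltr0n ?fact_gt0 // fact_prod natr_prod big_add1 /= big_mkord.
rewrite -[X in c ^+ X]card_ord -prodr_const -big_split /=.
(* Factor by factor, |tau - i| <= c + i <= c (i + 1) because c >= 1; the numbers i + 1 multiply to
   u!. *)
apply: ler_prod => i _; rewrite absc_ge0 /=.
apply: le_trans (ler_abscD _ _) _; rewrite abscN absc_nat -[i.+1%:R]natr1.
have : 0 <= (i : nat)%:R :> R by [].
have := c1; have := tc; nra.
Qed.

(* The coefficients c u form an invertible triangular system, solved recursively. *)
Lemma triangular_inverse_le (R : realType) (m : nat) (c f g : nat -> R[i]) (B : R) :
  c 0%N = 1 -> (forall u, absc (c u) <= 1) ->
  (forall l, (l < m)%N -> f l = \sum_(u < l.+1) c u * g (l - u)%N) ->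
  (forall l, (l < m)%N -> absc (f l) <= B) ->
  forall l, (l < m)%N -> absc (g l) <= 2 ^+ l * B.
Proof.
move=> c0 c1 fE fB l; elim/ltn_ind: l => l IH lm.
have -> : g l = f l - \sum_(u < l) c u.+1 * g (l - u.+1)%N.
  by rewrite fE // big_ord_recl c0 mul1r subn0 addrK.
apply: le_trans (ler_abscD _ _) _; rewrite abscN.
(* Since 2^l = 1 + (1 + 2 + ... + 2^(l-1)), there is room for the bound on [f l] and for those on
   all earlier [g]. *)
have -> : 2 ^+ l * B = B + \sum_(u < l) 2 ^+ u * B.
  by have := subrX1 (2 : R) l; rewrite -mulr_suml; set S := \sum_(_ < _) _; nra.
apply: lerD; first exact: fB.
apply: le_trans (absc_sum _ _ _) _.
rewrite [leRHS](reindex_inj rev_ord_inj) /=; apply: ler_sum => u _.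
have ul := ltn_ord u; have lu : (l - u.+1 < l)%N by lia.
apply: le_trans (IH _ lu (ltn_trans lu lm)).
by rewrite abscM ler_piMl // absc_ge0.
Qed.

Definition matS : 'M[int]_2 :=
  \matrix_(i, j) (if i == j then 0 else if i == 0 then -1 else 1).

Lemma SL2Z_matS : SL2Z matS.
Proof.
rewrite /SL2Z /= (expand_det_row _ ord0) !big_ord_recl big_ord0.
by rewrite /cofactor !det_mx11 !mxE.
Qed.

Lemma moebius_matS (R : realType) (tau : R[i]) : moebius matS tau = - tau^-1.
Proof. by rewrite /moebius !mxE /= mul0r add0r mul1r addr0 mulN1r. Qed.

Lemma Im_Ninv (R : realType) (tau : R[i]) :
  complex.Im (- tau^-1) = complex.Im tau / absc tau ^+ 2.
Proof. by rewrite sqr_absc; case: tau => a b /=; rewrite opprK. Qed.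

Section ModularStep.
Variables (R : realType) (t : nat) (m : 'I_t -> nat).
Variables (rho : 'M[int]_2 -> 'M[R[i]]_(\sum_r m r)%N).
Hypothesis rho_rep : representation rho.

Let M := (\sum_r m r)%N.

(** The constant A: 2^M comes from solving the triangular systems, the double sum from applying
    rho(S)^-1, and the last M from the number of terms in each binomial sum. *)
Definition growth_const : R :=
  2 ^+ M * (\sum_i \sum_j absc (invmx (rho matS) i j)) * M%:R.

(** M/2 pays for the factor |tau|^-M, and the quotient of logarithms is the beta with 2^beta = A +
    1. *)
Definition growth_exp : R := M%:R / 2 + ln (growth_const + 1) / ln 2.

Lemma growth_const_ge0 : 0 <= growth_const.
Proof.
rewrite !mulr_ge0 ?exprn_ge0 //; apply: sumr_ge0 => i _.
by apply: sumr_ge0 => j _; exact: absc_ge0.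
Qed.

Variables (k : int) (F : R[i] -> 'cV[R[i]]_(\sum_r m r)%N).
Variable h : 'I_t -> nat -> R[i] -> R[i].
Hypothesis F_aut : automorphic k rho F.
Hypothesis FE : forall (r : 'I_t) (l : 'I_(m r)) (tau : R[i]), upper_half tau ->
  F tau (tagnat.Rank r l) 0 = \sum_(u < l.+1) cbinom tau u * h r (l - u)%N tau.

Definition bounded_at (tau : R[i]) (B : R) :=
  forall r s, (s < m r)%N -> absc (h r s tau) <= B.

Lemma block_size_le r : (m r <= M)%N.
Proof. by rewrite /M (bigD1 r) //= leq_addr. Qed.

Lemma bounded_at_form (tau : R[i]) (c B : R) : upper_half tau ->
  1 <= c -> absc tau <= c -> 0 <= B -> bounded_at tau B ->
  forall i, absc (F tau i 0) <= M%:R * c ^+ M * B.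
Proof.
move=> Htau c1 tc B0 hB i; rewrite -(tagnat.sig2K i) FE //.
set r := tagnat.sig1 i; set l := tagnat.sig2 i.
apply: le_trans (absc_sum _ _ _) _.
apply: (@le_trans _ _ (\sum_(u < l.+1) c ^+ M * B)); last first.
  rewrite sumr_const card_ord -[leLHS]mulr_natl mulrA ler_wpM2r // ler_wpM2r ?exprn_ge0 //.
    by rewrite (le_trans _ c1).
  by rewrite ler_nat (leq_trans (ltn_ord l)) ?block_size_le.
apply: ler_sum => u _; rewrite abscM ler_pM ?absc_ge0 //.
  apply: le_trans (absc_cbinom_le _ c1 tc) _; rewrite ler_weXn2l //.
  by rewrite (leq_trans _ (block_size_le r)) // (leq_trans _ (ltn_ord l)) // ltnW.
by apply: hB; rewrite (leq_ltn_trans (leq_subr _ _)).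
Qed.

(** For |tau| <= 1 all binomials have modulus at most 1, so the h can be recovered from the
    components of F at the cost of a factor 2^M. *)
Lemma form_bounded_at (tau : R[i]) (B : R) : upper_half tau ->
  absc tau <= 1 -> (forall i, absc (F tau i 0) <= B) -> bounded_at tau (2 ^+ M * B).
Proof.
move=> Htau t1 FB r s sm.
have B0 : 0 <= B by apply: le_trans (FB (tagnat.Rank r (Ordinal sm))); exact: absc_ge0.
pose f l := \sum_(u < l.+1) cbinom tau u * h r (l - u)%N tau.
have := @triangular_inverse_le R (m r) (cbinom tau) f (fun l => h r l tau) B _ _ _ _ s sm.
move=> H; apply: le_trans (H _ _ _ _) _ => //.
- by rewrite /cbinom big_ord0 fact0 divr1.
- by move=> u; rewrite -[leRHS](expr1n _ u) absc_cbinom_le.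
- by move=> l lm; rewrite /f -(FE (Ordinal lm)).
- rewrite ler_wpM2r // ler_weXn2l ?ler1n // ltnW //.
  by rewrite (leq_trans sm) ?block_size_le.
Qed.

(** The bound travels from the h to F at -1/tau, through rho(S)^-1 to F at tau, and back to the
    h. *)
Lemma matS_step (tau : R[i]) (B : R) : upper_half tau -> absc tau <= 1 -> 0 <= B ->
  bounded_at (- tau^-1) B ->
  bounded_at tau (growth_const * absc tau ^ (- k) * (absc tau)^-1 ^+ M * B).
Proof.
move=> Htau t1 B0 hB.
have t_neq0 : tau != 0 by apply: contraTneq Htau => ->; rewrite /upper_half /= ltxx.
have t_gt0 : 0 < absc tau by rewrite absc_gt0.
have Htau' : upper_half (- tau^-1).
  by rewrite /upper_half /= Im_Ninv divr_gt0 ?exprn_gt0.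
have FB := bounded_at_form Htau' _ _ B0 hB (c := (absc tau)^-1).
have {}FB : forall i, absc (F (- tau^-1) i 0) <= M%:R * (absc tau)^-1 ^+ M * B.
  by apply: FB; [rewrite invf_ge1 | rewrite abscN abscV].
have FE' : F tau = invmx (rho matS) *m (tau ^ (- k) *: F (- tau^-1)).
  have := F_aut SL2Z_matS Htau.
  rewrite moebius_matS !mxE /= mul1r addr0 => ->.
  by rewrite mulKmx // (rep_unit rho_rep) //; exact: SL2Z_matS.
pose K := \sum_i \sum_j absc (invmx (rho matS) i j).
rewrite (_ : _ * B = 2 ^+ M * (K * (absc tau ^ (- k) * (M%:R * (absc tau)^-1 ^+ M * B)))).
  apply: form_bounded_at => // i; rewrite FE' mxE.
  apply: le_trans (absc_sum _ _ _) _.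
  apply: (@le_trans _ _ (\sum_j absc (invmx (rho matS) i j) *
      (absc tau ^ (- k) * (M%:R * (absc tau)^-1 ^+ M * B)))).
    apply: ler_sum => j _; rewrite mxE !abscM abscXz.
    by rewrite ler_wpM2l ?absc_ge0 // ler_wpM2l // exprz_ge0 // ltW.
  rewrite -mulr_suml ler_wpM2r //.
    by rewrite !mulr_ge0 ?exprz_ge0 ?exprn_ge0 ?invr_ge0 ?absc_ge0.
  rewrite /K [leRHS](bigD1 i) //=. rewrite lerDl sumr_ge0 // => i' _.
  by rewrite sumr_ge0 // => j _; exact: absc_ge0.
by rewrite /growth_const -/K; ring.
Qed.

Hypothesis h_periodic : forall (r : 'I_t) s tau (j : int), (s < m r)%N ->
  upper_half tau -> absc (h r s (tau + (j%:~R)%:C)) = absc (h r s tau).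

Let e : R := k%:~R / 2 + growth_exp.

(** With q = |tau|, q^-2 is the ratio of the heights of -1/tau and tau. It is at least 2, so its
    power beta exceeds A, while q^(-k-M) is exactly its power k/2 + M/2. *)
Lemma matS_step_power (q : R) : 0 < q -> q ^+ 2 <= 2^-1 ->
  growth_const * q ^ (- k) * q^-1 ^+ M <= (q ^+ 2)^-1 `^ e.
Proof.
move=> q0 q2; have ge0 := growth_const_ge0.
have q2E : (q ^+ 2)^-1 = q^-1 `^ 2 by rewrite -exprVn -powR_mulrn // invr_ge0 ltW.
rewrite q2E -powRrM /e /growth_exp.
set b := ln (growth_const + 1) / ln 2.
rewrite (_ : 2 * _ = k%:~R + (M%:R + 2 * b)); last by lra.
have qV0 : q^-1 != 0 by rewrite invr_eq0 gt_eqF.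
have qV_ge0 : 0 <= q^-1 by rewrite invr_ge0 ltW.
rewrite !powRD ?qV0 ?implybT // powR_intmul // powR_mulrn // exprz_inv.
rewrite [leRHS]mulrA [leRHS]mulrC -[leLHS]mulrA ler_wpM2r //.
  by rewrite mulr_ge0 ?exprn_ge0 // exprz_ge0 // ltW.
rewrite powRrM -q2E.
apply: (@le_trans _ _ (2 `^ (ln (growth_const + 1) / ln 2))).
  rewrite /powR gt_eqF // divfK ?lnK ?lerDl // ?gt_eqF ?ln_gt0 ?ltr1n //.
  by rewrite posrE ltr_wpDl.
rewrite ge0_ler_powR ?nnegrE ?invr_ge0 ?exprn_ge0 // ?(ltW q0) //.
  by rewrite divr_ge0 ?ln_ge0 ?ler1n // lerDr.
by rewrite -[leLHS]invrK lef_pV2 ?posrE ?exprn_gt0 // invr_gt0.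
Qed.

(* S followed by a translation at least doubles the height of a point of the
   strip lying below 1/2, without exceeding the inverse of its height. *)
Lemma bounded_at_descent (D Y : R) : 0 <= D ->
  (forall z : R[i], `|complex.Re z| <= 2^-1 -> 2^-1 <= complex.Im z -> complex.Im z <= Y ->
    bounded_at z (D * complex.Im z `^ (- e))) ->
  forall tau : R[i], `|complex.Re tau| <= 2^-1 -> upper_half tau ->
    Y^-1 <= complex.Im tau <= Y -> bounded_at tau (D * complex.Im tau `^ (- e)).
Proof.
move=> D0 base tau x_le Htau yY.
(* N doublings would bring the height to at least 1; the induction is on N. *)
have [N HN] : exists N, 1 <= 2 ^+ N * complex.Im tau.
  exists (Num.bound (complex.Im tau)^-1).
  by rewrite -ler_pdivrMr // div1r ltW // upper_nthrootP.
elim: N tau x_le Htau yY HN => [|N IH] tau x_le Htau /andP[Yy yY] HN.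
  by apply: base => //; move: HN; rewrite expr0 mul1r; apply: le_trans; lra.
have [half_le|y_lt] := leP 2^-1 (complex.Im tau); first exact: base.
(* Both coordinates are at most 1/2 in modulus. *)
have t2 : absc tau ^+ 2 <= 2^-1.
  move: x_le y_lt Htau; rewrite sqr_absc ler_norml /upper_half /= => /andP[]; nra.
have t_gt0 : 0 < absc tau.
  by rewrite absc_gt0; apply: contraTneq Htau => ->; rewrite /upper_half /= ltxx.
have t2_gt0 : 0 < absc tau ^+ 2 by rewrite exprn_gt0.
have Y0 : 0 < Y by apply: lt_le_trans yY.
(* The translation by j brings the real part of -1/tau into [-1/2, 1/2). *)
pose w := - tau^-1; pose j : int := - Num.floor (complex.Re w + 2^-1).
have Hw : upper_half w by rewrite /upper_half /= Im_Ninv divr_gt0.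
pose z := w + (j%:~R)%:C.
have Imz : complex.Im z = complex.Im tau / absc tau ^+ 2.
  by rewrite -Im_Ninv -/w /z; case: (w) => ? ? /=; rewrite addr0.
have Rez : complex.Re z = complex.Re w + j%:~R by rewrite /z; case: (w).
have y2 : 2 * complex.Im tau <= complex.Im z.
  by rewrite Imz mulrC ler_wpM2l ?(ltW Htau) // -[leLHS]invrK lef_pV2 ?posrE ?invr_gt0.
have y_gt0 : 0 < complex.Im tau by [].
(* Hence the new height y / |tau|^2 is at most 1/y <= Y, and the window [1/Y, Y] is preserved. *)
have y_sq : complex.Im tau ^+ 2 <= absc tau ^+ 2 by rewrite sqr_absc lerDr sqr_ge0.
have zB : bounded_at z (D * complex.Im z `^ (- e)).
  apply: IH.
  - have /andP[f1 f2] := mem_rg1_floor (complex.Re w + 2^-1).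
    rewrite Rez /j rmorphN ler_norml; apply/andP; split; lra.
  - by rewrite /upper_half /=; lra.
  - apply/andP; split; first lra.
    rewrite Imz ler_pdivrMr //; apply: le_trans (ler_wpM2l (ltW Y0) y_sq).
    by rewrite expr2 mulrA ler_peMl ?(ltW y_gt0) // -ler_pdivrMl // mulr1.
  - apply: le_trans HN _; rewrite exprS mulrAC [leLHS]mulrC ler_wpM2l ?exprn_ge0 //.
have wB : bounded_at w (D * complex.Im z `^ (- e)).
  by move=> r s sm; rewrite -(h_periodic j sm Hw); exact: zB.
have B0 : 0 <= D * complex.Im z `^ (- e) by rewrite mulr_ge0 ?powR_ge0.
have t1 : absc tau <= 1 by rewrite -(@ler_sqr _) ?nnegrE ?absc_ge0 // expr1n; lra.
move=> r s sm; apply: le_trans (matS_step Htau t1 B0 wB sm) _.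
apply: (@le_trans _ _ ((absc tau ^+ 2)^-1 `^ e * (D * complex.Im z `^ (- e)))).
  by rewrite ler_wpM2r // matS_step_power.
(* The power |tau|^(-2e) cancels the one in (y / |tau|^2)^-e and leaves y^-e. *)
rewrite Imz powRM ?invr_ge0 ?(ltW t2_gt0) ?(ltW y_gt0) // mulrCA.
rewrite [_ `^ e * _]mulrCA -[(absc tau ^+ 2)^-1 `^ e * _]powRD ?subrr ?powRr0 ?mulr1 //.
by rewrite (gt_eqF (_ : 0 < (absc tau ^+ 2)^-1)) ?invr_gt0 // implybT.
Qed.

End ModularStep.

(** * Elementary estimates and uniform constants *)

Lemma expR_decay_le_powR (R : realType) (c p : R) : 0 < c ->
  exists2 D, 0 <= D & forall y : R, 2^-1 <= y -> expR (- (c * (y - 2^-1))) <= D * y `^ p.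
Proof.
(* The inequality ln x <= x at x = c y / E bounds E ln(2y), hence -p ln(2y), by c y plus a constant;
   2y is used because its logarithm is nonnegative. In the witness, c/2 comes from the shift by 1/2
   and |p| ln 2 from returning to ln y. *)
move=> c0; pose E := `|p| + 1; have E0 : 0 < E by rewrite ltr_wpDl.
exists (expR (c / 2 + E * `|ln (2 * E / c)| + `|p| * ln 2)) => [|y y2]; first exact: expR_ge0.
have y0 : 0 < y by apply: lt_le_trans y2; rewrite invr_gt0.
rewrite /powR gt_eqF // -expRD ler_expR.
pose x := c * y / E; have x0 : 0 < x by rewrite divr_gt0 // mulr_gt0.
have K0 : 0 < 2 * E / c by rewrite divr_gt0 // mulr_gt0.
have lnE : ln (2 * y) = ln x + ln (2 * E / c).
  rewrite -lnM ?posrE //; congr ln; rewrite /x; field; lra.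
have lnx : ln x <= x.
  have : ln (1 + (x - 1)) <= x - 1 by apply: le_ln1Dx; lra.
  by rewrite addrCA subrr addr0; lra.
have ln2y : 0 <= ln (2 * y) by rewrite ln_ge0 //; lra.
have ln2 : 0 <= ln (2 : R) by rewrite ln_ge0 // ler1n.
have Ex : E * x = c * y by rewrite /x; field; rewrite gt_eqF.
have key : - p * ln (2 * y) <= c * y + E * `|ln (2 * E / c)|.
  apply: (@le_trans _ _ (E * ln (2 * y))).
    by rewrite ler_wpM2r // /E; have := ler_norm (- p); rewrite normrN; lra.
  rewrite lnE mulrDr -Ex lerD //; rewrite ler_wpM2l ?(ltW E0) //; exact: ler_norm.
have lnyE : ln (2 * y) = ln 2 + ln y by rewrite lnM ?posrE.
have pln : p * ln 2 <= `|p| * ln 2 by rewrite ler_wpM2r // ler_norm.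
move: key; rewrite lnyE; lra.
Qed.

Lemma uniform_bound (R : realType) (t : nat) (m : 'I_t -> nat)
    (P : 'I_t -> nat -> R -> Prop) :
  (forall r s (C C' : R), C <= C' -> P r s C -> P r s C') ->
  (forall r s, (s < m r)%N -> exists2 C, 0 <= C & P r s C) ->
  exists2 C, 0 <= C & forall r s, (s < m r)%N -> P r s C.
Proof.
move=> mono ex.
have /choice [C HC] : forall rs : {r : 'I_t & 'I_(m r)},
    exists C, 0 <= C /\ P (tag rs) (tagged rs) C.
  by move=> [r s]; have [C C0 HC] := ex r s (ltn_ord s); exists C.
exists (\sum_rs C rs) => [|r s sm]; first by apply: sumr_ge0 => rs _; have [] := HC rs.
pose rs : {r : 'I_t & 'I_(m r)} := Tagged (fun r => 'I_(m r)) (Ordinal sm).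
apply: (mono _ _ (C rs)); last by have [] := HC rs.
by rewrite (bigD1 rs) //= lerDl sumr_ge0 // => i _; have [] := HC i.
Qed.

Lemma int_gap (R : realType) (mu : R) :
  exists2 d, 0 < d & forall n : int, 0 < n%:~R + mu -> d <= n%:~R + mu.
Proof.
have /andP[_ f2] := floor_itv (- mu).
(* The floor of -mu plus one is the least integer above -mu. *)
exists ((Num.floor (- mu) + 1)%:~R + mu) => [|n n0]; first lra.
rewrite lerD2r ler_int -ltzD1 ltrD2r -(ltr_int R).
have /andP[f1 _] := floor_itv (- mu); lra.
Qed.

(** * From bounds near the real axis to Fourier coefficients *)

Section Coefficients.
Variables (R : realType) (t : nat) (m : 'I_t -> nat) (mu : 'I_t -> R).
Implicit Types (h : 'I_t -> nat -> R[i] -> R[i]) (a : 'I_t -> nat -> int -> R[i]).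

(** The height is taken as y = n^-j, which turns y^-p into n^(jp) and keeps the exponential factor
    bounded below, as (n + mu0) / n^j <= 1 + |mu0|. *)
Lemma coef_size_bigO (mu0 : R) (a : int -> R[i]) (G p : R) (j : nat) : (0 < j)%N -> 0 <= G ->
  (forall (y : R) (n : int), 0 < y <= 2^-1 -> coef_size mu0 a y n <= G * y `^ (- p)) ->
  (fun n : nat => a (Posz n) : R[i]^o) =O_\oo
  (fun n : nat => (n%:R `^ (j%:R * p))%:C : R[i]^o).
Proof.
move=> j0 G0 aG; apply/eqO_exP.
pose E := expR (2 * pi * (1 + `|mu0|)); have E0 : 0 < E by exact: expR_gt0.
(* The added 1 keeps the constant positive when G = 0; n >= 2 ensures y <= 1/2. *)
exists ((G + 1) * E)%:C; first by rewrite ltcR mulr_gt0 // ltr_wpDl.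
exists 2%N => // n /= n2; rewrite !abscE -rmorphM /= lecR absc_real ?powR_ge0 //.
have n0 : 0 < n%:R :> R by rewrite ltr0n (leq_trans _ n2).
have nj : n%:R <= n%:R ^+ j :> R.
  by rewrite -[leLHS]expr1 ler_weXn2l // ler1n (leq_trans _ n2).
have n2' : 2 <= n%:R :> R by rewrite ler_nat.
have nj0 : 0 < n%:R ^+ j :> R by rewrite exprn_gt0.
have := aG (n%:R ^+ j)^-1 (Posz n) _.
rewrite invr_gt0 nj0 lef_pV2 ?posrE // (le_trans n2' nj) => /(_ isT).
have -> : (n%:R ^+ j)^-1 `^ (- p) = n%:R `^ (j%:R * p) :> R.
  by rewrite -powR_mulrn ?(ltW n0) // -powRN -powRrM mulrNN.
rewrite /coef_size -pmulrn => H.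
have H2 : expR (- (2 * pi * (n%:R + mu0) * (n%:R ^+ j)^-1)) >= E^-1.
  rewrite -expRN ler_expR lerN2 -mulrA ler_wpM2l ?mulr_ge0 ?pi_ge0 //.
  rewrite ler_pdivrMr // mulrDl mul1r lerD //.
  by rewrite (le_trans (ler_norm _)) // ler_peMr // (le_trans _ nj) //; lra.
have powge0 : 0 <= n%:R `^ (j%:R * p) :> R by exact: powR_ge0.
apply: (@le_trans _ _ (G * n%:R `^ (j%:R * p) * E)); last first.
  by rewrite mulrAC ler_wpM2r // ler_wpM2r ?(ltW E0) // lerDl.
rewrite -ler_pdivrMr //; apply: le_trans H.
by rewrite ler_wpM2l ?absc_ge0.
Qed.

Lemma strip_absc_le1 (tau : R[i]) :
  `|complex.Re tau| <= 2^-1 -> 0 < complex.Im tau <= 2^-1 -> absc tau <= 1.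
Proof.
move=> x_le /andP[y0 y1].
rewrite -(@ler_sqr _) ?nnegrE ?absc_ge0 // expr1n sqr_absc.
by move: x_le; rewrite ler_norml => /andP[]; nra.
Qed.

(* Both expansions describe the same F, which transfers bounds from one to the
   other without proving that Fourier expansions are unique. *)
Lemma coef_size_form_le (F : R[i] -> 'cV[R[i]]_(\sum_r m r)%N) h h' a (G p : R) :
  (forall r s tau, (s < m r)%N -> upper_half tau ->
     has_zsum (fun n : int => a r s n * qpow (n%:~R + mu r) tau) (h r s tau)) ->
  (forall (r : 'I_t) (l : 'I_(m r)) tau, upper_half tau ->
     F tau (tagnat.Rank r l) 0 = \sum_(u < l.+1) cbinom tau u * h r (l - u)%N tau) ->
  (forall (r : 'I_t) (l : 'I_(m r)) tau, upper_half tau ->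
     F tau (tagnat.Rank r l) 0 = \sum_(u < l.+1) cbinom tau u * h' r (l - u)%N tau) ->
  0 <= G ->
  (forall tau, `|complex.Re tau| <= 2^-1 -> 0 < complex.Im tau <= 2^-1 ->
     bounded_at m h' tau (G * complex.Im tau `^ p)) ->
  forall r s y n, (s < m r)%N -> 0 < y <= 2^-1 ->
    coef_size (mu r) (a r s) y n <=
      2 ^+ (\sum_r m r) * ((\sum_r m r)%:R * G) * y `^ p.
Proof.
move=> hz FE FE' G0 h'G r s y n sm y01; have [y0 _] := andP y01.
apply: (coef_size_le (fun tau => hz r s tau sm)) => // x x01.
have Htau : upper_half (x +i* y) by [].
have x_le : `|complex.Re (x +i* y)| <= 2^-1 by rewrite ler_norml.
have t1 := strip_absc_le1 x_le y01.
have := h'G _ x_le y01; move=> /(bounded_at_form FE' Htau (lexx 1) t1).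
move=> /(_ (mulr_ge0 G0 (powR_ge0 _ _))) /(form_bounded_at FE Htau t1) /(_ r s sm).
by rewrite expr1n mulr1 -!mulrA.
Qed.

End Coefficients.

(** * The growth estimates for holomorphic and cuspidal forms *)

Unset Implicit Arguments.

Theorem theorem4p1 (R : realType) (t : nat) (m : 'I_t -> nat)
    (lambda : 'I_t -> R[i]) (rho : 'M[int]_2 -> 'M[R[i]]_(\sum_r m r)%N)
    (m_gt0 : forall r, (0 < m r)%N)
    (lambda_norm1 : forall r, `|lambda r| = 1)
    (rho_rep : representation rho)
    (rhoT : rho matT = \mxdiag_r jblock (m r) (lambda r)) :
  exists alpha : R,
    forall mu : 'I_t -> R,
    (forall r, lambda r = cexp (0 +i* (2 * pi * mu r))) ->
    forall (k : int) (F : R[i] -> 'cV[R[i]]_(\sum_r m r)%N)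
           (a : 'I_t -> nat -> int -> R[i]),
    Hspace mu k rho F -> fourier_coeffs mu F a ->
    (forall (r : 'I_t) (s : nat), (s < m r)%N ->
       (fun n : nat => a r s (Posz n) : R[i]^o) =O_\oo
       (fun n : nat => (n%:R `^ (k%:~R + alpha))%:C : R[i]^o))
    /\ (cuspidal_form mu F ->
        forall (r : 'I_t) (s : nat), (s < m r)%N ->
          (fun n : nat => a r s (Posz n) : R[i]^o) =O_\oo
          (fun n : nat => (n%:R `^ (k%:~R / 2 + alpha / 2))%:C : R[i]^o)).
Proof.
exists (2 * growth_exp rho) => mu _ k F a [_ F_aut F_hol] [h [hz FE]].
pose e : R := k%:~R / 2 + growth_exp rho.
have half0 : 0 < 2^-1 :> R by rewrite invr_gt0.
(* Holomorphy and cuspidality come with an expansion [h'] of their own; a bound y^-p on it yields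
   n^(jp) for the given coefficients [a]. *)
have reduce h' (j : nat) (G p : R) : (0 < j)%N -> 0 <= G ->
    (forall (r : 'I_t) (l : 'I_(m r)) tau, upper_half tau ->
      F tau (tagnat.Rank r l) 0 = \sum_(u < l.+1) cbinom tau u * h' r (l - u)%N tau) ->
    (forall tau, `|complex.Re tau| <= 2^-1 -> 0 < complex.Im tau <= 2^-1 ->
      bounded_at m h' tau (G * complex.Im tau `^ (- p))) ->
    forall r s, (s < m r)%N ->
      (fun n : nat => a r s (Posz n) : R[i]^o) =O_\oo
      (fun n : nat => (n%:R `^ (j%:R * p))%:C : R[i]^o).
  move=> j0 G0 FE' h'G r s sm.
  have coef := coef_size_form_le hz FE FE' G0 h'G.
  apply: (coef_size_bigO j0 _ (fun y n => coef r s y n sm)).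
  by rewrite !mulr_ge0 // exprn_ge0.
have periodic h' a' :
    (forall r s tau, (s < m r)%N -> upper_half tau ->
      has_zsum (fun n : int => a' r s n * qpow (n%:~R + mu r) tau) (h' r s tau)) ->
    forall (r : 'I_t) s tau (j : int), (s < m r)%N -> upper_half tau ->
      absc (h' r s (tau + (j%:~R)%:C)) = absc (h' r s tau).
  move=> hz' r s tau j sm Htau.
  exact: (absc_qseries_periodic (fun tau => hz' r s tau sm)).
have low (y : R) : 0 < y <= 2^-1 -> y^-1^-1 <= y <= y^-1.
  move=> /andP[y0 y2]; rewrite invrK lexx /= (le_trans y2) //.
  by rewrite -[leLHS]invrK lef_pV2 ?posrE ?invr_gt0 ?invrK //; lra.
split; last first.
  case=> a' [h' [hz' FE']] van.
  (* Exponential decay beats any power of the height, so D serves at all heights above 1/2, whatever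
     the sign of e. *)
  have [D D0 HD] : exists2 D, 0 <= D & forall r s, (s < m r)%N -> forall tau,
      2^-1 <= complex.Im tau -> absc (h' r s tau) <= D * complex.Im tau `^ (- e).
    apply: uniform_bound => [r s C C' CC' HC tau Htau|r s sm].
      by apply: le_trans (HC tau Htau) _; rewrite ler_wpM2r // powR_ge0.
    have [d d0 dgap] := int_gap (mu r).
    have [n|C C0 HC] := qseries_le (fun tau => hz' r s tau sm) (ltW d0).
      move=> an; apply: dgap; rewrite ltNge; apply: contra an => /(van r s n sm) ->.
      by [].
    have c0 : 0 < 2 * pi * d by rewrite !mulr_gt0 ?pi_gt0.
    have [D D0 HD] := expR_decay_le_powR (- e) c0.
    exists (C * D) => [|tau Htau]; first exact: mulr_ge0.
    by apply: le_trans (HC tau Htau) _; rewrite -[leRHS]mulrA ler_wpM2l // HD.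
  move=> r s sm; rewrite (_ : _ + _ = 1%:R * e); last by rewrite /e; lra.
  apply: (reduce h' 1%N D e _ D0 FE' _ r s sm) => // tau x_le /[dup] y01 /andP[y0 y2].
  apply: (bounded_at_descent rho_rep F_aut FE' (periodic _ _ hz') D0 _ x_le y0 (low _ y01)).
  by move=> z _ z2 _ r' s' sm'; exact: HD.
have [a' [h' [hz' FE']] van] := F_hol.
have [C C0 HC] : exists2 C, 0 <= C & forall r s, (s < m r)%N -> forall tau,
    2^-1 <= complex.Im tau -> absc (h' r s tau) <= C.
  apply: uniform_bound => [r s C C' CC' HC tau Htau|r s sm].
    by apply: le_trans (HC tau Htau) _.
  have [n|C C0 HC] := qseries_le (fun tau => hz' r s tau sm) (lexx 0).
    by move=> an; rewrite leNgt; apply: contra an => /(van r s n sm) ->.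
  exists C => // tau Htau; have := HC tau Htau.
  by rewrite mulr0 mul0r oppr0 expR0 mulr1.
move=> r s sm; have [e0|e0] := leP 0 e.
  rewrite (_ : _ + _ = 1%:R * (2 * e)); last by rewrite /e; lra.
  apply: (reduce h' 1%N C (2 * e) _ C0 FE' _ r s sm) => // tau x_le /[dup] y01 /andP[y0 y2].
  (* The descent is run with a constant that depends on the starting height y: heights z met in the
     base case are at most 1/y, so z^e <= y^-e and C <= (C y^-e) z^-e. The outcome is C y^(-2e). *)
  rewrite (_ : C * _ = C * (complex.Im tau)^-1 `^ e * complex.Im tau `^ (- e)); last first.
    rewrite -powR_inv1 ?(ltW y0) // -powRrM -mulrA -powRD ?(gt_eqF y0) ?implybT //.
    by congr (_ * _ `^ _); ring.
  apply: (bounded_at_descent rho_rep F_aut FE' (periodic _ _ hz') _ _ x_le y0 (low _ y01)).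
    by rewrite mulr_ge0 ?powR_ge0.
  move=> z _ z2 zY r' s' sm'; have z0 := lt_le_trans half0 z2.
  apply: le_trans (HC _ _ sm' _ z2) _.
  rewrite -[leRHS]mulrA ler_peMr // powRN ler_pdivlMr ?powR_gt0 // mul1r.
  by rewrite ge0_ler_powR // ?nnegrE ?invr_ge0 ltW.
(* For e < 0 the bound y^-e improves as y tends to 0: at y = n^-2 it is n^(2e). *)
rewrite (_ : _ + _ = 2%:R * e); last by rewrite /e; lra.
(* As -e > 0, z^-e >= (1/2)^-e for z >= 1/2, which the factor (1/2)^e compensates. *)
have D0 : 0 <= C * 2^-1 `^ e by rewrite mulr_ge0 ?powR_ge0.
apply: (reduce h' 2%N _ e _ D0 FE' _ r s sm) => // tau x_le /[dup] y01 /andP[y0 y2].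
apply: (bounded_at_descent rho_rep F_aut FE' (periodic _ _ hz') D0 _ x_le y0 (low _ y01)).
move=> z _ z2 zY r' s' sm'; have z0 := lt_le_trans half0 z2.
apply: le_trans (HC _ _ sm' _ z2) _.
rewrite -[leRHS]mulrA ler_peMr // -[X in 2^-1 `^ X]opprK (powRN _ (- e)).
rewrite mulrC ler_pdivlMr ?powR_gt0 // mul1r.
by rewrite ge0_ler_powR // ?nnegrE ?oppr_ge0 ltW.
Qed.
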